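(* In dimension $n=2$ there are no strongly isolated lattices; that is, no $\Lambda\in\mathcal{L}_2$ is strongly isolated.
   Context: Here $n=2$. $G=\mathrm{SL}_n(\mathbb{R})$, $A\subset G$ is the subgroup of diagonal matrices with positive diagonal entries, and $\mathcal{L}_n\cong G/\mathrm{SL}_n(\mathbb{Z})$ is the space of lattices in $\mathbb{R}^n$ of covolume $1$. Mordell constant: a symmetric box is a set $[-a_1,a_1]\times\cdots\times[-a_n,a_n]$ with $a_i>0$; it is admissible for a lattice $\Lambda\subset\mathbb{R}^n$ if its interior contains no nonzero point of $\Lambda$. Then $\kappa(\Lambda)=\sup_{\mathcal{B}}\frac{\mathrm{Vol}(\mathcal{B})}{2^n\mathrm{Vol}(\Lambda)}$, the supremum over symmetric boxes $\mathcal{B}$ admissible for $\Lambda$, where $\mathrm{Vol}(\Lambda)$ is the covolume. Isolation: for $\varepsilon_0>0$, $\Lambda\in\mathcal{L}_n$ is $\varepsilon_0$-isolated if for every $0<\varepsilon<\varepsilon_0$ there is a neighborhood $\mathcal{U}$ of $\Lambda$ in $\mathcal{L}_n$ such that $\kappa(\Lambda')>\kappa(\Lambda)+\varepsilon$ for all $\Lambda'\in\mathcal{U}\smallsetminus A\Lambda$. $\Lambda$ is strongly isolated if it is $\varepsilon_0$-isolated for $\varepsilon_0=1-\kappa(\Lambda)$ (in particular, being strongly isolated requires $\varepsilon_0=1-\kappa(\Lambda)>0$). *)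

(* Defs.v *)
From HB Require Import structures.
From mathcomp Require Import all_boot all_order all_algebra.
From mathcomp Require Import all_classical all_reals all_analysis.
Import Order.TTheory GRing.Theory Num.Theory.
Import numFieldNormedType.Exports.

Set Implicit Arguments.
Unset Strict Implicit.
Unset Printing Implicit Defensive.

Local Open Scope classical_set_scope.
Local Open Scope ring_scope.

Section Lattices.
Context {R : realType} {n : nat}.
Implicit Types (g h : 'M[R]_n) (L : set 'cV[R]_n).

Definition lattice_of g : set 'cV[R]_n :=
  [set g *m map_mx intr z | z in [set: 'cV[int]_n]].

Definition lattice_basis L : set 'M[R]_n :=
  [set g | g \in unitmx /\ lattice_of g = L].

Definition is_lattice L := exists g, lattice_basis L g.

(* Independent of the chosen basis by [covolE]; a junk value if L is not a
   lattice. *)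
Definition covol L : R := `|\det (xget 0 (lattice_basis L))|.

Lemma lattice_of_subset g h : lattice_of h `<=` lattice_of g ->
  exists M : 'M[int]_n, h = g *m map_mx intr M.
Proof.
move=> sub.
have /boolp.choice[f fP] (j : 'I_n) :
    exists z : 'cV[int]_n, g *m map_mx intr z = col j h.
  have : lattice_of g (col j h).
    apply: sub; exists (delta_mx j 0) => //=.
    by rewrite map_delta_mx -colE.
  by case=> z _ <-; exists z.
exists (\matrix_(i, j) f j i 0); apply/matrixP => i j.
have /matrixP/(_ i 0) := fP j; rewrite !mxE => <-.
by apply: eq_bigr => k _; rewrite !mxE.
Qed.

Lemma map_intr_inj m p : injective (map_mx intr : 'M[int]_(m, p) -> 'M[R]_(m, p)).
Proof.
move=> A B /matrixP AB; apply/matrixP => i j.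
by have := AB i j; rewrite !mxE => /intr_inj.
Qed.

Lemma lattice_basis_eq g h : g \in unitmx ->
  lattice_of g = lattice_of h ->
  exists2 M : 'M[int]_n, M \in unitmx & h = g *m map_mx intr M.
Proof.
move=> gU e.
have [M hM] : exists M : 'M[int]_n, h = g *m map_mx intr M.
  by apply: lattice_of_subset; rewrite e.
have [N gN] : exists N : 'M[int]_n, g = h *m map_mx intr N.
  by apply: lattice_of_subset; rewrite e.
exists M => //.
have : M *m N = 1%:M.
  apply: map_intr_inj; rewrite map_mxM map_mx1 /=.
  by rewrite -[LHS]mul1mx -(mulVmx gU) -!mulmxA (mulmxA g) -hM -gN.
by case/mulmx1_unit.
Qed.

Lemma covolE g : g \in unitmx -> covol (lattice_of g) = `|\det g|.
Proof.
move=> gU; rewrite /covol; case: xgetP => [h _ [hU he]|/(_ g)]; last first.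
  by case; split.
have [M MU ->] := lattice_basis_eq hU he.
rewrite det_mulmx det_map_mx normrM.
have /orP[/eqP->|/eqP->] : (\det M == 1) || (\det M == -1).
  by move: MU; rewrite unitmxE.
- by rewrite normr1 mulr1.
- by rewrite rmorphN1 normrN1 mulr1.
Qed.

End Lattices.

Record ulattice (R : realType) (n : nat) := ULattice {
  ulattice_set :> set 'cV[R]_n;
  ulatticeP : is_lattice ulattice_set /\ covol ulattice_set = 1 }.

Definition SL (R : realType) (n : nat) : set 'M[R]_n := [set g | \det g = 1].
Arguments SL : clear implicits.

Lemma SL_ulattice (R : realType) (n : nat) (g : SL R n) :
  is_lattice (lattice_of (set_val g)) /\ covol (lattice_of (set_val g)) = 1.
Proof.
have /set_mem g1 := valP g.
have gU : set_val g \in unitmx by rewrite unitmxE /set_val/= g1 unitr1.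
split; first by exists (set_val g).
by rewrite covolE// /set_val/= g1 normr1.
Qed.

Definition SL_to_ulattice (R : realType) (n : nat) (g : SL R n) :
  ulattice R n := ULattice (SL_ulattice g).

(* The topology on the space of lattices is the quotient topology along
   [SL_to_ulattice], which is surjective with fibres the orbits of right
   translation by SL_n(Z) ([SL_to_ulattice_surj], [SL_to_ulattice_fibre]). *)
Section LatticeTopology.
Context {R : realType} {n : nat}.

HB.instance Definition _ := gen_eqMixin (ulattice R n).
HB.instance Definition _ := gen_choiceMixin (ulattice R n).

Definition ulattice_open (U : set (ulattice R n)) : Prop :=
  open (@SL_to_ulattice R n @^-1` U).

Let ulattice_openT : ulattice_open setT.
Proof. by rewrite /ulattice_open preimage_setT; exact: openT. Qed.

Let ulattice_openI : setI_closed ulattice_open.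
Proof. by move=> U V; exact: openI. Qed.

Let ulattice_open_bigU (I : Type) (f : I -> set (ulattice R n)) :
  (forall i, ulattice_open (f i)) -> ulattice_open (\bigcup_i f i).
Proof. by move=> fo; apply: bigcup_open => i _; exact: fo. Qed.

HB.instance Definition _ := isOpenTopological.Build (ulattice R n)
  ulattice_openT ulattice_openI ulattice_open_bigU.

Lemma ulattice_inj (L L' : ulattice R n) :
  L = L' :> set 'cV[R]_n -> L = L'.
Proof.
by case: L L' => [L p] [L' p'] /= e; subst L'; congr ULattice; exact: Prop_irrelevance.
Qed.

Lemma SL_to_ulattice_surj (L : ulattice R n) :
  exists g, SL_to_ulattice g = L.
Proof.
have [[g [gU gL]]] := ulatticeP L.
rewrite -gL covolE// => d1.
suff [h h1 hL] : exists2 h : 'M[R]_n, \det h = 1 & lattice_of h = L.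
  by exists (SigSub (mem_set h1 : h \in SL R n)); exact: ulattice_inj.
have [d0|d0] := leP 0 (\det g); first by exists g; rewrite // -d1 ger0_norm.
have dN : \det g = -1 by rewrite -d1 ltr0_norm// opprK.
case: n L g gU gL d1 d0 dN => [|m] L g gU gL _ _ dN.
  by exists g => //; rewrite det_mx00.
pose D : 'M[int]_m.+1 :=
  diag_mx (\row_i (if i == 0 then -1 else 1 : int)).
have DD : D *m D = 1%:M.
  rewrite mulmx_diag; apply/matrixP => i j; rewrite !mxE.
  by case: ifP => _; rewrite ?mulrNN mulr1.
exists (g *m map_mx intr D).
  rewrite det_mulmx det_map_mx dN det_diag big_ord_recl big1 ?mxE ?mulr1/=.
    by rewrite rmorphN1 mulrNN mulr1.
  by move=> i _; rewrite mxE.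
rewrite -gL; apply/seteqP; split => x [z _ <-].
  by exists (D *m z) => //; rewrite map_mxM mulmxA.
exists (D *m z) => //.
by rewrite map_mxM -mulmxA (mulmxA (map_mx _ D)) -map_mxM DD map_mx1 mul1mx.
Qed.

Lemma SL_to_ulattice_fibre (g h : SL R n) :
  SL_to_ulattice g = SL_to_ulattice h <->
  exists2 M : 'M[int]_n, \det M = 1 & set_val h = set_val g *m map_mx intr M.
Proof.
have /set_mem g1 := valP g; have /set_mem h1 := valP h; split.
  move=> /(congr1 (@ulattice_set _ _))/= e.
  have gU : set_val g \in unitmx by rewrite unitmxE /set_val/= g1 unitr1.
  have [M _ hM] := lattice_basis_eq gU e.
  exists M => //; apply: (@intr_inj R).
  rewrite -det_map_mx -[LHS]mul1r -[X in X * _]g1 -det_mulmx.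
  by rewrite [X in X *m _](_ : _ = set_val g)// -hM.
case=> M M1 hM; apply: ulattice_inj => /=; rewrite hM.
have MU : M \in unitmx by rewrite unitmxE M1 unitr1.
apply/seteqP; split => x [z _ <-].
  exists (invmx M *m z) => //.
  by rewrite -mulmxA -map_mxM mulmxA mulmxV// mul1mx.
by exists (M *m z) => //; rewrite map_mxM mulmxA.
Qed.

End LatticeTopology.

Section Mordell.
Context {R : realType} {n : nat}.

Definition symbox (a : 'I_n -> R) : set 'cV[R]_n :=
  [set x | forall i, - a i <= x i 0 <= a i].

Definition symbox_vol (a : 'I_n -> R) : R := \prod_i (2 * a i).

Definition admissible (L : set 'cV[R]_n) (a : 'I_n -> R) : Prop :=
  (forall i, 0 < a i) /\ (forall x, L x -> (symbox a)° x -> x = 0).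

(* By Minkowski's theorem the set below is bounded by 1, so this is a genuine
   supremum and not the default value of [sup]. *)
Definition kappa (L : set 'cV[R]_n) : R :=
  sup [set symbox_vol a / (2 ^+ n * covol L) | a in admissible L].

Definition diag_pos : set 'M[R]_n :=
  [set a | \det a = 1 /\ is_diag_mx a /\ forall i, 0 < a i i].

Definition diag_orbit (L : ulattice R n) : set (ulattice R n) :=
  [set L' | exists2 a, diag_pos a & L' = mulmx a @` L :> set 'cV[R]_n].

Definition isolated (e0 : R) (L : ulattice R n) : Prop :=
  0 < e0 /\
  forall e, 0 < e -> e < e0 ->
    exists2 U, nbhs L U &
      forall L', (U `\` diag_orbit L) L' -> kappa L' > kappa L + e.

Definition strongly_isolated (L : ulattice R n) : Prop :=
  isolated (1 - kappa L) L.

End Mordell.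

(* Main.v *)
Require Import Defs.
From mathcomp Require Import all_boot all_order all_algebra.
From mathcomp Require Import all_classical all_reals all_analysis.
From mathcomp Require Import ring lra zify.
Import Order.TTheory GRing.Theory Num.Theory.
Import numFieldNormedType.Exports.

Set Implicit Arguments.
Unset Strict Implicit.
Unset Printing Implicit Defensive.

Local Open Scope classical_set_scope.
Local Open Scope ring_scope.

(* For a unimodular planar lattice put N(L) = inf |x y| over its nonzero points.
   A primitive point (x, y) with x != 0 makes the box with half sides |x| and
   (1 - |x y|) / |x| admissible, so N >= 1 - kappa. Conversely, walking along
   the divided cells of L until the box separates the two basis vectors gives
   kappa <= 1 - N^2. If kappa(L) < 1, choose a divided cell of L that is very
   high and narrow and apply the horizontal shear that makes the ratio of its
   abscissas -sqrt 2 or -sqrt 3. The shear is close to the identity, and the new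
   lattice still has N >= N(L)^2 / 6: in the sector of the cell this is the
   Liouville bound for a quadratic irrational, outside it |x| changes by a
   bounded factor only. So kappa stays bounded away from 1 on both sheared
   lattices, and they cannot both lie in the A-orbit of L because the fields
   Q(sqrt 2) and Q(sqrt 3) differ. *)

(** * Bases and divided cells of planar lattices *)

Section PlaneLattices.
Context {R : realType}.
Implicit Types (S : R -> R -> Prop) (a b c d e A B T x y : R).

(** A lattice is a relation on coordinates, so that changes of basis, shears and reflections become
    identities between real numbers. *)
Definition spans S x1 y1 x2 y2 := forall x y, S x y <->
  exists m n : int, x = m%:~R * x1 + n%:~R * x2 /\ y = m%:~R * y1 + n%:~R * y2.

(** The condition [N >= e], stated without an infimum. *)
Definition product_ge e S :=
  forall x y, S x y -> (x != 0) || (y != 0) -> e <= `|x * y|.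

Definition reflect_x S x y := S (- x) y.

Lemma spansC S x1 y1 x2 y2 : spans S x1 y1 x2 y2 -> spans S x2 y2 x1 y1.
Proof.
by move=> H x y; rewrite H; split=> -[m [n [-> ->]]]; exists n, m; split; ring.
Qed.

Lemma spansN S x1 y1 x2 y2 : spans S x1 y1 x2 y2 -> spans S (- x1) (- y1) x2 y2.
Proof.
by move=> H x y; rewrite H; split=> -[m [n [-> ->]]]; exists (- m), n; split; ring.
Qed.

Lemma spansD S x1 y1 x2 y2 :
  spans S x1 y1 x2 y2 -> spans S (x1 + x2) (y1 + y2) x2 y2.
Proof.
move=> H x y; rewrite H; split=> -[m [n [-> ->]]].
  by exists m, (n - m); split; ring.
by exists m, (n + m); split; ring.
Qed.

Lemma spansB S x1 y1 x2 y2 :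
  spans S x1 y1 x2 y2 -> spans S (x1 - x2) (y1 - y2) x2 y2.
Proof.
move=> H x y; rewrite H; split=> -[m [n [-> ->]]].
  by exists m, (n + m); split; ring.
by exists m, (n - m); split; ring.
Qed.

Lemma spans1 S x1 y1 x2 y2 : spans S x1 y1 x2 y2 -> S x1 y1.
Proof. by move=> H; rewrite H; exists 1, 0; split; ring. Qed.

Lemma spans_reflect_x S x1 y1 x2 y2 :
  spans S x1 y1 x2 y2 -> spans (reflect_x S) (- x1) y1 (- x2) y2.
Proof.
move=> H x y; rewrite /reflect_x H; split=> -[m [n [hx ->]]]; exists m, n; split=> //.
  by rewrite -[x]opprK hx; ring.
by rewrite hx; ring.
Qed.

Lemma product_ge_reflect_x e S : product_ge e S -> product_ge e (reflect_x S).
Proof.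
move=> H x y Sxy xy; have := H _ _ Sxy; rewrite oppr_eq0 mulNr normrN.
exact.
Qed.

Lemma reflect_xK S : reflect_x (reflect_x S) = S.
Proof. by apply/funext => x; apply/funext => y; rewrite /reflect_x opprK. Qed.

(* A divided cell in the sense of Delone, with the sign of the abscissa of the
   first basis vector (-a, c) made explicit. *)
Definition divided S a b c d :=
  [/\ [/\ 0 < a, 0 < b, 0 < c & 0 < d], a * d + b * c = 1 & spans S (- a) c b d].

Lemma divided_reflect_x S a b c d :
  divided S a b c d -> divided (reflect_x S) b a d c.
Proof.
move=> [[a0 b0 c0 d0] e H]; split=> //; first by rewrite addrC.
by have := spansC (spans_reflect_x H); rewrite opprK.
Qed.

Section FixedLattice.
Variables (S : R -> R -> Prop) (e : R).
Hypotheses (e0 : 0 < e) (Se : product_ge e S).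

(** This excludes the ties in the basis changes below: a tie would put a nonzero point on an
    axis. *)
Lemma product_ge_neq0 x y : S x y -> (x != 0) || (y != 0) -> x != 0 /\ y != 0.
Proof.
move=> Sxy xy; have := Se Sxy xy.
have [->|x0] := eqVneq x 0; first by rewrite mul0r normr0 leNgt e0.
by have [->|y0] := eqVneq y 0; first by rewrite mulr0 normr0 leNgt e0.
Qed.

(** [a * c] and [b * d] are the values of [|x y|] at the basis vectors, so [(a * d) * (b * c)] is at
    least [e ^+ 2]; its two factors are at most 1 because they add up to 1. *)
Lemma divided_bounds a b c d : divided S a b c d ->
  [/\ e <= a * c, e <= b * d, a * d <= 1, b * c <= 1 &
    e ^+ 2 <= a * d /\ e ^+ 2 <= b * c].
Proof.
move=> [[a0 b0 c0 d0] h H].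
have ac : e <= a * c.
  have := Se (spans1 H); rewrite oppr_eq0 gt_eqF//= mulNr normrN.
  by rewrite gtr0_norm ?mulr_gt0//; exact.
have bd : e <= b * d.
  have := Se (spans1 (spansC H)); rewrite gt_eqF//=.
  by rewrite gtr0_norm ?mulr_gt0//; exact.
have ad0 : 0 < a * d by rewrite mulr_gt0.
have bc0 : 0 < b * c by rewrite mulr_gt0.
have h1 : e * e <= (a * c) * (b * d) by apply: ler_pM => //; exact: ltW.
have h2 : (a * d) * (b * c) <= a * d by rewrite ler_piMr// ?ltW//; lra.
have h3 : (a * d) * (b * c) <= b * c by rewrite ler_piMl// ?ltW//; lra.
by rewrite expr2; split=> //; [lra|lra|split; lra].
Qed.

(** The sum of the basis vectors replaces the one on its side of the vertical axis; the cell becomes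
    higher and narrower. *)
Lemma divided_forward a b c d : divided S a b c d ->
  (b < a /\ divided S (a - b) b (c + d) d) \/
  (a < b /\ divided S a (b - a) c (c + d)).
Proof.
move=> [[a0 b0 c0 d0] h H].
have [ab|ab|ab] := ltgtP a b; last 1 first.
- have := product_ge_neq0 (spans1 (spansD H)).
  by rewrite ab addNr eqxx/= gt_eqF ?addr_gt0//= => /(_ isT)[].
- right; split=> //; split; [split=> //; lra|lra|].
  by have := spansC (spansD (spansC H)); rewrite [d + c]addrC.
- left; split=> //; split; [split=> //; lra|lra|].
  by rewrite (_ : - (a - b) = - a + b); [exact: spansD | ring].
Qed.


(** The difference of the basis vectors, oriented upward, replaces the one on its side; the cell
    becomes lower and wider. *)
Lemma divided_backward a b c d : divided S a b c d ->
  (d < c /\ divided S (a + b) b (c - d) d) \/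
  (c < d /\ divided S a (a + b) c (d - c)).
Proof.
move=> [[a0 b0 c0 d0] h H].
have [cd|cd|cd] := ltgtP c d; last 1 first.
- have := product_ge_neq0 (spans1 (spansB H)).
  rewrite cd subrr eqxx orbF lt_eqF; last lra.
  by move=> /(_ isT)[].
- right; split=> //; split; [split=> //; lra|lra|].
  by have := spansC (spansB (spansC H)); rewrite opprK [b + a]addrC.
- left; split=> //; split; [split=> //; lra|lra|].
  by have := spansB H; rewrite -opprD.
Qed.

(* The descent is Euclid's algorithm on two basis vectors of the same quadrant;
   it ends because the heights stay below T, which keeps the abscissas above
   e / T. *)
Lemma divided_exists_descent T k x1 y1 x2 y2 : spans S x1 y1 x2 y2 ->
  `|x1 * y2 - x2 * y1| = 1 -> 0 < x1 -> 0 < y1 -> 0 < x2 -> 0 < y2 ->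
  y1 <= T -> y2 <= T -> x1 + x2 <= k%:R * (e / T) ->
  exists a b c d, divided S a b c d.
Proof.
elim: k x1 y1 x2 y2 => [|k IH] x1 y1 x2 y2 H det x10 y10 x20 y20 y1T y2T xk.
  lra.
have T0 : 0 < T by lra.
have xeT x y : 0 < x -> 0 < y -> y <= T -> S x y -> e / T <= x.
  move=> x0 y0 yT Sxy; rewrite ler_pdivrMr//.
  have := Se Sxy; rewrite gt_eqF//= gtr0_norm ?mulr_gt0// => /(_ isT) h.
  by rewrite (le_trans h)// ler_pM2l.
have hx1 := xeT _ _ x10 y10 y1T (spans1 H).
have hx2 := xeT _ _ x20 y20 y2T (spans1 (spansC H)).
(* Every subtraction lowers [x1 + x2] by an abscissa, hence by at least [e / T]; [k] counts the
   steps that remain possible. *)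
rewrite -[in X in _ <= X]addn1 natrD mulrDl mul1r in xk.
have nz : (x1 - x2 != 0) || (y1 - y2 != 0).
  rewrite -negb_and; apply/negP => /andP[]; rewrite !subr_eq0 => /eqP ex /eqP ey.
  by move: det; rewrite ex ey subrr normr0 => /eqP; rewrite eq_sym oner_eq0.
have [] := product_ge_neq0 (spans1 (spansB H)) nz; rewrite !subr_eq0.
case: (ltgtP x1 x2) => // hx _; case: (ltgtP y1 y2) => // hy _.
- apply: (IH x1 y1 (x2 - x1) (y2 - y1)); [exact: spansC (spansB (spansC H)) | |lra..].
  by rewrite -det; congr `|_|; ring.
(* When abscissas and ordinates compare oppositely, the difference, oriented upward, lies in the
   second quadrant and forms a divided cell with the vector of larger abscissa. *)
- exists (x2 - x1), x2, (y1 - y2), y2; split; first by split; lra.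
    have : x1 * y2 < x2 * y1 by apply: ltr_pM => //; exact: ltW.
    by rewrite -subr_lt0 => /ltr0_norm; rewrite det => h; rewrite [RHS]h; ring.
  by have := spansB H; rewrite -[x1 - x2]opprB.
- exists (x1 - x2), x1, (y2 - y1), y1; split; first by split; lra.
    have : x2 * y1 < x1 * y2 by apply: ltr_pM => //; exact: ltW.
    by rewrite -subr_gt0 => /gtr0_norm; rewrite det => h; rewrite [RHS]h; ring.
  by have := spansB (spansC H); rewrite -[x2 - x1]opprB.
- apply: (IH (x1 - x2) (y1 - y2) x2 y2); [exact: spansB| |lra..].
  by rewrite -det; congr `|_|; ring.
Qed.

End FixedLattice.

(** After sign changes both ordinates are positive. Vectors on opposite sides of the vertical axis
    already form a divided cell; on the same side the descent applies, after a reflection if that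
    side is the left one. *)
Lemma divided_exists S e x1 y1 x2 y2 : 0 < e -> product_ge e S ->
  spans S x1 y1 x2 y2 -> `|x1 * y2 - x2 * y1| = 1 ->
  exists a b c d, divided S a b c d.
Proof.
move=> e0 Se H det.
have pos S' x1' y1' x2' y2' : product_ge e S' -> spans S' x1' y1' x2' y2' ->
    `|x1' * y2' - x2' * y1'| = 1 -> 0 < x1' -> 0 < y1' -> 0 < x2' -> 0 < y2' ->
    exists a b c d, divided S' a b c d.
  move=> Se' H' det' x1p y1p x2p y2p; pose T := Num.max y1' y2'.
  have T0 : 0 < T by rewrite lt_max y1p.
  have eT : 0 < e / T by rewrite divr_gt0.
  apply: (@divided_exists_descent S' e e0 Se' T
    (Num.bound ((x1' + x2') / (e / T))) x1' y1' x2' y2') => //.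
  - by rewrite le_max lexx.
  - by rewrite le_max lexx orbT.
  - by rewrite -ler_pdivrMr// ltW// archi_boundP// divr_ge0 ?addr_ge0// ltW.
have nz1 : (x1 != 0) || (y1 != 0).
  rewrite -negb_and; apply/negP => /andP[/eqP x0 /eqP y0].
  by move: det; rewrite x0 y0 mul0r mulr0 subrr normr0 => /eqP; rewrite eq_sym oner_eq0.
have nz2 : (x2 != 0) || (y2 != 0).
  rewrite -negb_and; apply/negP => /andP[/eqP x0 /eqP y0].
  by move: det; rewrite x0 y0 mul0r mulr0 subrr normr0 => /eqP; rewrite eq_sym oner_eq0.
have [{nz1} x1n y1n] := product_ge_neq0 e0 Se (spans1 H) nz1.
have [{nz2} x2n y2n] := product_ge_neq0 e0 Se (spans1 (spansC H)) nz2.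
wlog y1p : x1 y1 x1n y1n H det / 0 < y1.
  move=> W; have [y1p|y1N|y10] := ltgtP 0 y1; first exact: (W x1 y1).
    apply: (W (- x1) (- y1)); rewrite ?oppr_eq0 ?oppr_gt0//; first exact: spansN.
    by rewrite -det -normrN; congr `|_|; ring.
  by rewrite -y10 eqxx in y1n.
wlog y2p : x2 y2 x2n y2n H det / 0 < y2.
  move=> W; have [y2p|y2N|y20] := ltgtP 0 y2; first exact: (W x2 y2).
    apply: (W (- x2) (- y2)); rewrite ?oppr_eq0 ?oppr_gt0//.
      exact: spansC (spansN (spansC H)).
    by rewrite -det -normrN; congr `|_|; ring.
  by rewrite -y20 eqxx in y2n.
have [x1p|x1N|x10] := ltgtP 0 x1; last by rewrite -x10 eqxx in x1n.
- have [x2p|x2N|x20] := ltgtP 0 x2; last by rewrite -x20 eqxx in x2n.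
    exact: (pos S x1 y1 x2 y2).
  exists (- x2), x1, y2, y1; split; first by split; rewrite ?oppr_gt0.
    rewrite -det gtr0_norm; first by ring.
    by rewrite subr_gt0 (@lt_trans _ _ 0)// ?mulr_gt0// nmulr_rlt0.
  by rewrite opprK; exact: spansC.
- have [x2p|x2N|x20] := ltgtP 0 x2; last by rewrite -x20 eqxx in x2n.
    exists (- x1), x2, y1, y2; split; first by split; rewrite ?oppr_gt0.
      rewrite -det ltr0_norm; first by ring.
      by rewrite subr_lt0 (@lt_trans _ _ 0)// ?mulr_gt0// nmulr_rlt0.
    by rewrite opprK.
  have x1p : 0 < - x1 by rewrite oppr_gt0.
  have x2p : 0 < - x2 by rewrite oppr_gt0.
  have det' : `|- x1 * y2 - - x2 * y1| = 1.
    by rewrite -det -normrN; congr `|_|; ring.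
  have [a [b [c [d D]]]] := pos _ _ _ _ _ (product_ge_reflect_x Se)
    (spans_reflect_x H) det' x1p y1p x2p y2p.
  exists b, a, d, c.
  by have := divided_reflect_x D; rewrite reflect_xK.
Qed.

End PlaneLattices.

(** * Upper bound for the area of a box free of lattice points *)

Section BoxBound.
Context {R : realType}.
Implicit Types (S : R -> R -> Prop) (a b c d e A B T x y : R).

(** [A] and [B] are half sides; the inequalities are strict because admissibility concerns the
    interior. *)
Definition box_free S A B :=
  forall x y, S x y -> `|x| < A -> `|y| < B -> x = 0 /\ y = 0.

Section FixedLattice.
Variables (S : R -> R -> Prop) (e : R).
Hypotheses (e0 : 0 < e) (Se : product_ge e S).

(** The box separates the basis vectors: one is too high for it, the other too wide. So [A * B] is
    at most [b * c] or [a * d], each being 1 minus the other. *)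
Lemma divided_corner_bound A B a b c d : 0 < A -> 0 < B -> divided S a b c d ->
  (A <= b /\ B <= c) \/ (A <= a /\ B <= d) -> A * B <= 1 - e ^+ 2.
Proof.
move=> A0 B0 D; have [_ _ _ _ [ad bc]] := divided_bounds e0 Se D.
have [[a0 b0 c0 d0] h _] := D.
case=> -[hA hB].
  by have : A * B <= b * c by [apply: ler_pM => //; exact: ltW]; lra.
by have : A * B <= a * d by [apply: ler_pM => //; exact: ltW]; lra.
Qed.

Section FixedBox.
Variables (A B : R).
Hypotheses (A0 : 0 < A) (B0 : 0 < B) (AB : box_free S A B).

Lemma divided_box_free a b c d : divided S a b c d ->
  (A <= a \/ B <= c) /\ (A <= b \/ B <= d).
Proof.
move=> [[a0 b0 c0 d0] h H]; split.
  have [|aA] := leP A a; first by left.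
  have [|cB] := leP B c; first by right.
  have [] := AB (spans1 H); rewrite ?normrN ?gtr0_norm// => /eqP.
  by rewrite oppr_eq0 gt_eqF.
have [|bA] := leP A b; first by left.
have [|dB] := leP B d; first by right.
have [] := AB (spans1 (spansC H)); rewrite ?normrN ?gtr0_norm// => /eqP.
by rewrite gt_eqF.
Qed.

(** While both heights are below [B], both vectors are excluded by their abscissas. Once the sum
    vector reaches height [B], the box separates it from the vector that is kept. Each step raises
    [c + d < B + B] by at least [t], so [k] bounds the number of steps. *)
Lemma box_free_forward k t a b c d : divided S a b c d -> c < B -> d < B ->
  t <= c -> t <= d -> B + B <= c + d + k%:R * t -> A * B <= 1 - e ^+ 2.
Proof.
elim: k a b c d => [|k IH] a b c d D cB dB tc td; first lra.
rewrite -[in X in _ <= X]addn1 natrD mulrDl mul1r => kB.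
have [[a0 b0 c0 d0] h H] := D.
have [ac bd] := divided_box_free D.
have [[ba D']|[ab D']] := divided_forward e0 Se D.
  have [cdB|cdB] := ltP (c + d) B; first by apply: IH D' _ _ _ _ _; lra.
  by apply: (divided_corner_bound A0 B0 D'); left; case: bd => ?; lra.
have [cdB|cdB] := ltP (c + d) B; first by apply: IH D' _ _ _ _ _; lra.
by apply: (divided_corner_bound A0 B0 D'); right; case: ac => ?; lra.
Qed.

(** Mirror image of [box_free_forward], with abscissas in place of heights. *)
Lemma box_free_backward k t a b c d : divided S a b c d -> a < A -> b < A ->
  t <= a -> t <= b -> A + A <= a + b + k%:R * t -> A * B <= 1 - e ^+ 2.
Proof.
elim: k a b c d => [|k IH] a b c d D aA bA ta tb; first lra.
rewrite -[in X in _ <= X]addn1 natrD mulrDl mul1r => kA.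
have [[a0 b0 c0 d0] h H] := D.
have [ac bd] := divided_box_free D.
have [[cd D']|[cd D']] := divided_backward e0 Se D.
  have [abA|abA] := ltP (a + b) A; first by apply: IH D' _ _ _ _ _; lra.
  by apply: (divided_corner_bound A0 B0 D'); right; case: bd => ?; lra.
have [abA|abA] := ltP (a + b) A; first by apply: IH D' _ _ _ _ _; lra.
by apply: (divided_corner_bound A0 B0 D'); left; case: ac => ?; lra.
Qed.

End FixedBox.

Lemma exists_natmul_ge T x : 0 < x -> exists k, T <= k%:R * x.
Proof.
move=> x0; exists (Num.bound `|T / x|); rewrite -ler_pdivrMr//.
by rewrite (le_trans (ler_norm _))// ltW// archi_boundP.
Qed.

(** Unless the box already separates the basis vectors, both heights are below [B] or both abscissas
    are below [A], and one of the two walks applies. *)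
Lemma box_free_bound A B a b c d : 0 < A -> 0 < B -> box_free S A B ->
  divided S a b c d -> A * B <= 1 - e ^+ 2.
Proof.
move=> A0 B0 AB D; have [[a0 b0 c0 d0] h H] := D.
have [ac bd] := divided_box_free AB D.
have [cB|Bc] := ltP c B; last first.
  have [bA|Ab] := ltP b A; last by apply: (divided_corner_bound A0 B0 D); left.
  have [aA|Aa] := ltP a A; last first.
    by apply: (divided_corner_bound A0 B0 D); right; case: bd; lra.
  have m0 : 0 < Num.min a b by rewrite lt_min a0.
  have [k kP] := exists_natmul_ge (A + A) m0.
  apply: (box_free_backward A0 B0 AB D aA bA (t := Num.min a b) (k := k)); last lra.
    by rewrite ge_min lexx.
  by rewrite ge_min lexx orbT.
have [dB|Bd] := ltP d B; last first.
  by apply: (divided_corner_bound A0 B0 D); right; case: ac; lra.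
have m0 : 0 < Num.min c d by rewrite lt_min c0.
have [k kP] := exists_natmul_ge (B + B) m0.
apply: (box_free_forward A0 B0 AB D cB dB (t := Num.min c d) (k := k)); last lra.
  by rewrite ge_min lexx.
by rewrite ge_min lexx orbT.
Qed.

(** [e <= a * c] with [a * d <= 1], and symmetrically, make the heights comparable within the factor
    [e]; a large sum of heights then forces both to be large. *)
Lemma divided_ratio a b c d : divided S a b c d -> e * d <= c /\ e * c <= d.
Proof.
move=> D; have [ac bd ad bc _] := divided_bounds e0 Se D.
have [[a0 b0 c0 d0] h H] := D.
split.
  have : e * d <= a * c * d by rewrite ler_pM2r.
  have : (a * d) * c <= c by rewrite ler_piMl// ltW.
  lra.
have : e * c <= b * d * c by rewrite ler_pM2r.
have : (b * c) * d <= d by rewrite ler_piMl// ltW.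
lra.
Qed.

Lemma divided_le1 a b c d : divided S a b c d -> e <= 1.
Proof.
move=> D; have [_ _ ad _ [e2 _]] := divided_bounds e0 Se D.
by have := le_trans e2 ad; rewrite expr_le1// ltW.
Qed.

Lemma divided_high_sum k t a b c d : divided S a b c d -> t <= c -> t <= d ->
  exists a' b' c' d',
    [/\ divided S a' b' c' d', t <= c', t <= d' & k%:R * t <= c' + d'].
Proof.
move=> D tc td; have [[a0 b0 c0 d0] _ _] := D.
elim: k => [|k [a' [b' [c' [d' [D' tc' td' h]]]]]].
  by exists a, b, c, d; split=> //; lra.
rewrite -addn1 natrD mulrDl mul1r; have [[a'0 b'0 c'0 d'0] _ _] := D'.
have [[ba D'']|[ab D'']] := divided_forward e0 Se D'.
  by exists (a' - b'), b', (c' + d'), d'; split=> //; lra.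
by exists a', (b' - a'), c', (c' + d'); split=> //; lra.
Qed.

Lemma divided_high T a b c d : divided S a b c d ->
  exists a' b' c' d', [/\ divided S a' b' c' d', T <= c' & T <= d'].
Proof.
move=> D; have [[a0 b0 c0 d0] _ _] := D.
(* The factor [e] serves the final estimate, where [e * (c' + d')] is at most both [2 * c'] and
   [2 * d']. *)
have m0 : 0 < e * Num.min c d by rewrite mulr_gt0// lt_min c0.
have [k kP] := exists_natmul_ge (T + T) m0.
have [||a' [b' [c' [d' [D' _ _ h]]]]] := divided_high_sum k (t := Num.min c d) D.
- by rewrite ge_min lexx.
- by rewrite ge_min lexx orbT.
exists a', b', c', d'.
have [cd dc] := divided_ratio D'; have e1 := divided_le1 D'.
have [[a'0 b'0 c'0 d'0] _ _] := D'.
have eh : T + T <= e * (c' + d').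
  by rewrite (le_trans kP)// mulrCA ler_pM2l.
have ed : e * d' <= d' by rewrite ler_piMl// ltW.
have ec : e * c' <= c' by rewrite ler_piMl// ltW.
by split=> //; lra.
Qed.

End FixedLattice.
End BoxBound.

(** * Quadratic forms over the integers and the fields of [sqrt 2] and [sqrt 3] *)

Section QuadraticIrrationals.

(** For nonzero [j] and [k] the [p]-adic valuations of the two sides would have the parities of
    those of [A] and [B], which differ. *)
Lemma quadratic_eq0 (p A B : nat) (j k : int) :
  (0 < A)%N -> (0 < B)%N -> odd (logn p A) != odd (logn p B) ->
  A%:Z * j ^+ 2 = B%:Z * k ^+ 2 -> j = 0 /\ k = 0.
Proof.
move=> A0 B0 odAB /(congr1 absz); rewrite !expr2 !abszM !mulnn /=.
have [->|j0] := eqVneq j 0.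
  move/esym/eqP; rewrite absz0 exp0n// muln0 muln_eq0 expn_eq0 absz_eq0.
  by rewrite (gtn_eqF B0) andbT => /eqP.
have [->|k0] := eqVneq k 0.
  move/eqP; rewrite absz0 exp0n// muln0 muln_eq0 expn_eq0 absz_eq0.
  by rewrite (gtn_eqF A0) andbT => /eqP.
have j1 : (0 < `|j|)%N by rewrite absz_gt0.
have k1 : (0 < `|k|)%N by rewrite absz_gt0.
move/(congr1 (odd \o logn p)) => /=.
rewrite !lognM ?muln_gt0 ?j1 ?k1// !oddD !addbb !addbF => e.
by rewrite e eqxx in odAB.
Qed.

Variable R : realType.

(* [Z + Z sqrt 2] and [Z + Z sqrt 3] are not homothetic. *)
Lemma sqrt2_sqrt3_indep (i j k l : int) :
  Num.sqrt 3 * (l%:~R + k%:~R * Num.sqrt 2) = j%:~R + i%:~R * Num.sqrt 2 :> R ->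
  l%:~R + k%:~R * Num.sqrt 2 = 0 :> R.
Proof.
set r2 := Num.sqrt 2; set r3 := Num.sqrt 3 => e.
have r22 : r2 ^+ 2 = 2 by rewrite sqr_sqrtr.
have r32 : r3 ^+ 2 = 3 by rewrite sqr_sqrtr.
(* The squares of the two sides of the hypothesis differ by [P - Q * r2]. *)
pose P := 3 * (l ^+ 2 + 2 * k ^+ 2) - (j ^+ 2 + 2 * i ^+ 2) : int.
pose Q := 2 * (i * j) - 6 * (l * k) : int.
have PQ : P%:~R = Q%:~R * r2 :> R.
  have : r3 ^+ 2 * (l%:~R + k%:~R * r2) ^+ 2 = (j%:~R + i%:~R * r2) ^+ 2.
    by rewrite -exprMn e.
  rewrite r32 /P /Q => h; apply/eqP; rewrite -subr_eq0; apply/eqP.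
  transitivity (3 * (l%:~R + k%:~R * r2) ^+ 2 - (j%:~R + i%:~R * r2) ^+ 2
     + (2 - r2 ^+ 2) * (3 * k%:~R ^+ 2 - i%:~R ^+ 2)); first by ring.
  by rewrite h r22; ring.
have [P0 Q0] : P = 0 /\ Q = 0.
  apply: (@quadratic_eq0 2 1 2) => //.
  apply: (@intr_inj R); rewrite !expr2 !rmorphM /= PQ.
  by transitivity (Q%:~R ^+ 2 * r2 ^+ 2 : R); [ring | rewrite r22; ring].
(* Inserting [i * j = 3 * (l * k)], which is [Q = 0], into [j ^+ 2 * P = 0] gives this
   factorization. *)
have : (j ^+ 2 - 3 * l ^+ 2) * (j ^+ 2 - 6 * k ^+ 2) = 0.
  have -> : (j ^+ 2 - 3 * l ^+ 2) * (j ^+ 2 - 6 * k ^+ 2) =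
    - j ^+ 2 * P - 2 * (i * j) ^+ 2 + 18 * (l * k) ^+ 2 by rewrite /P /Q; ring.
  have -> : i * j = 3 * (l * k) by move: Q0; rewrite /Q; lia.
  by rewrite P0; ring.
move=> /eqP; rewrite mulf_eq0 !subr_eq0 => /orP[] /eqP jE.
  have [j0 l0] : j = 0 /\ l = 0.
    by apply: (@quadratic_eq0 3 1 3) => //; rewrite mul1r.
  have [i0 k0] : i = 0 /\ k = 0.
    apply: (@quadratic_eq0 3 2 6) => //.
    apply/eqP; rewrite -subr_eq0; apply/eqP; rewrite -oppr0 -P0 /P j0 l0; ring.
  by rewrite l0 k0 mul0r addr0.
have [j0 k0] : j = 0 /\ k = 0.
  by apply: (@quadratic_eq0 2 1 6) => //; rewrite mul1r.
have [i0 l0] : i = 0 /\ l = 0.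
  apply: (@quadratic_eq0 2 2 3) => //.
  apply/eqP; rewrite -subr_eq0; apply/eqP; rewrite -oppr0 -P0 /P j0 k0; ring.
by rewrite l0 k0 mul0r addr0.
Qed.

(** The norm from the field of [sqrt p] is an integer here, and it is nonzero because [p] has odd
    valuation at itself. *)
Lemma norm_form_ge1 (p : nat) (m n : int) : prime p -> (m != 0) || (n != 0) ->
  1 <= `|n%:~R ^+ 2 - p%:R * m%:~R ^+ 2| :> R.
Proof.
move=> pp mn.
have -> : n%:~R ^+ 2 - p%:R * m%:~R ^+ 2 = (n ^+ 2 - p%:Z * m ^+ 2)%:~R :> R.
  by rewrite rmorphB rmorphXn/= rmorphM/= rmorphXn.
rewrite -intr_norm ler1z -gtz0_ge1 normr_gt0 subr_eq0.
apply: contraTneq mn => h.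
have [] // := @quadratic_eq0 p 1 p n m isT (prime_gt0 pp).
- by rewrite logn1 logn_prime// eqxx.
- by rewrite mul1r.
- by move=> -> ->; rewrite eqxx.
Qed.

End QuadraticIrrationals.

(** * Shearing a divided cell to a quadratic irrational ratio *)

Section Shear.
Context {R : realType}.
Implicit Types (S : R -> R -> Prop) (a b c d e s t x y : R).

(** The image of [S] under the map sending [(x, y)] to [(x + s * y, y)], hence the inverse map in
    the body. *)
Definition shear s S x y := S (x - s * y) y.

Lemma spans_shear s S x1 y1 x2 y2 : spans S x1 y1 x2 y2 ->
  spans (shear s S) (x1 + s * y1) y1 (x2 + s * y2) y2.
Proof.
move=> H x y; rewrite /shear H; split=> -[m [n [hx hy]]]; exists m, n; split=> //.
  by rewrite -[x](subrK (s * y)) hx hy; ring.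
by rewrite hx hy; ring.
Qed.

(** The solution [s] of [a - s * c = t * (b + s * d)]: the sheared abscissas have ratio [- t]. *)
Definition shear_to t a b c d := (a - t * b) / (c + t * d).

(** The heights do not change, so the ratio [t] and the area 1 determine the new abscissas. *)
Lemma divided_shear S t a b c d : 0 < t -> divided S a b c d ->
  divided (shear (shear_to t a b c d) S) (t / (c + t * d)) (1 / (c + t * d)) c d.
Proof.
move=> t0 [[a0 b0 c0 d0] h H].
have w0 : 0 < c + t * d by rewrite addr_gt0// mulr_gt0.
have wn : c + t * d != 0 by rewrite gt_eqF.
split.
- by split=> //; rewrite divr_gt0.
- by field.
have := spans_shear (shear_to t a b c d) H.
have -> : - a + shear_to t a b c d * c = - (t / (c + t * d)).
  rewrite (_ : t / _ = t * (a * d + b * c) / (c + t * d)) ; last by rewrite h mulr1.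
  by rewrite /shear_to; field.
have -> // : b + shear_to t a b c d * d = 1 / (c + t * d).
by rewrite /shear_to -h; field.
Qed.

(** In the sector of the cell the Liouville bound yields [e / 6]; outside it the comparison of
    abscissas yields [e ^+ 2 / 3]. The bound [p <= 4] gives [t <= 2]. *)
Lemma product_ge_shear S e (p : nat) a b c d : prime p -> (p <= 4)%N -> 0 < e ->
  product_ge e S -> divided S a b c d ->
  product_ge (e ^+ 2 / 6) (shear (shear_to (Num.sqrt p%:R) a b c d) S).
Proof.
move=> pp p4 e0 Se D.
set t := Num.sqrt p%:R.
have t2 : t ^+ 2 = p%:R by rewrite sqr_sqrtr.
have t1 : 1 <= t.
  rewrite -(@ler_pXn2r _ 2)// ?nnegrE ?sqrtr_ge0//.
  by rewrite t2 expr1n ler1n prime_gt0.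
have tle2 : t <= 2.
  rewrite -(@ler_pXn2r _ 2)// ?nnegrE ?sqrtr_ge0// t2.
  by rewrite -natrX ler_nat.
have t0 : 0 < t by lra.
have e1 := divided_le1 e0 Se D.
have [cd dc] := divided_ratio e0 Se D.
have [_ _ ad bc _] := divided_bounds e0 Se D.
have [_ _ DS] := divided_shear t0 D.
have [[a0 b0 c0 d0] h H] := D.
set w := c + t * d in DS.
have td : t * d <= 2 * d by rewrite ler_pM2r.
have w0 : 0 < w by rewrite addr_gt0// mulr_gt0.
have ec : e * c <= c by rewrite ler_piMl// ltW.
have ed : e * d <= d by rewrite ler_piMl// ltW.
have ew : e * w <= e * (c + 2 * d) by rewrite ler_pM2l// lerD2l.
move=> x y /DS[m [n [-> ->]]]; set M := m%:~R; set N := n%:~R => xy.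
have mn : (m != 0) || (n != 0).
  rewrite -negb_and; apply: contraL xy => /andP[/eqP m0 /eqP n0].
  by rewrite /M /N m0 n0 !mul0r addr0 eqxx.
have XE : M * - (t / w) + N * (1 / w) = (N - t * M) / w by field; rewrite gt_eqF.
rewrite XE normrM [`|_ / w|]normrM [`|w^-1|]gtr0_norm ?invr_gt0//.
have M0 := normr_ge0 M; have N0 := normr_ge0 N.
have tM : `|M| <= t * `|M| by rewrite ler_peMl.
have Y0 := normr_ge0 (M * c + N * d).
(* If [M * N >= 0], the ordinates add up without cancellation; [N - t * M] may be small, but its
   conjugate [N + t * M] is at most [2 * (|M| + |N|)] in absolute value. *)
have [MN|MN] := leP 0 (M * N).
  have nf : 1 <= `|N - t * M| * (2 * (`|M| + `|N|)).
    rewrite (le_trans (norm_form_ge1 R pp mn))// -t2 -exprMn subr_sqr normrM.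
    rewrite ler_wpM2l// (le_trans (ler_normD _ _))//.
    rewrite normrM (gtr0_norm t0).
    have : t * `|M| <= 2 * `|M| by rewrite ler_wpM2r.
    lra.
  have Y : `|M * c + N * d| = `|M| * c + `|N| * d.
    have [M1|M1] := leP 0 M; have [N1|N1] := leP 0 N.
    - by rewrite (ger0_norm M1) (ger0_norm N1) ger0_norm// addr_ge0// mulr_ge0// ltW.
    - have -> : M = 0 by apply/eqP; rewrite eq_le M1 -(nmulr_lge0 _ N1) MN.
      by rewrite normr0 !mul0r !add0r normrM (gtr0_norm d0).
    - have -> : N = 0 by apply/eqP; rewrite eq_le N1 -(nmulr_rge0 _ M1) MN.
      by rewrite normr0 !mul0r !addr0 normrM (gtr0_norm c0).
    - rewrite (ltr0_norm M1) (ltr0_norm N1) ltr0_norm; first by ring.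
      have Mc : M * c < 0 by rewrite pmulr_llt0.
      have Nd : N * d < 0 by rewrite pmulr_llt0.
      lra.
  (* Since [w <= c + 2 * d] and the heights are comparable within [e], [e * w] is at most [3 * c]
     and [3 * d]. *)
  have Yw : e / 3 * w * (`|M| + `|N|) <= `|M * c + N * d|.
    have wc : e / 3 * w <= c by lra.
    have wd : e / 3 * w <= d by lra.
    rewrite Y mulrDr [_ * `|M|]mulrC [_ * `|N|]mulrC.
    by apply: lerD; apply: ler_wpM2l.
  have e2 : e ^+ 2 <= e by rewrite expr2 ler_piMl// ltW.
  rewrite (@le_trans _ _ (e / 6 * 1))//; first lra.
  rewrite (@le_trans _ _ (e / 6 * (`|N - t * M| * (2 * (`|M| + `|N|)))))//.
    by rewrite ler_pM2l// divr_gt0.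
  rewrite (_ : e / 6 * _ =
    `|N - t * M| / w * (e / 3 * w * (`|M| + `|N|))); last by field; rewrite gt_eqF.
  by rewrite ler_wpM2l// divr_ge0// ltW.
(* Now [M] and [N] have opposite signs, so nothing cancels in the new abscissa. *)
have XN : `|N - t * M| = `|N| + t * `|M|.
  have [M1|M1] := leP 0 M; have [N1|N1] := leP 0 N.
  - by move: MN; rewrite ltNge mulr_ge0.
  - rewrite (ltr0_norm N1) (ger0_norm M1) ltr0_norm; first by ring.
    by rewrite subr_lt0 (lt_le_trans N1)// mulr_ge0// ltW.
  - rewrite (ltr0_norm M1) (ger0_norm N1) ger0_norm; first by ring.
    by rewrite subr_ge0 (le_trans _ N1)// pmulr_rle0// ltW.
  - by move: MN; rewrite ltNge mulr_le0// ltW.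
have xn : M * - a + N * b != 0.
  have [M1|M1] := leP 0 M.
    have N1 : N < 0.
      by rewrite ltNge; apply/negP => N1; move: MN; rewrite ltNge mulr_ge0.
    rewrite lt_eqF// mulrN addrC subr_lt0 (@lt_le_trans _ _ 0)//.
      by rewrite pmulr_llt0.
    by rewrite mulr_ge0// ltW.
  have N1 : 0 <= N.
    by rewrite leNgt; apply/negP => N1; move: MN; rewrite ltNge mulr_le0// ltW.
  rewrite gt_eqF// mulrN addrC subr_gt0 (@lt_le_trans _ _ 0)//.
    by rewrite pmulr_llt0.
  by rewrite mulr_ge0// ltW.
have Sxy : S (M * - a + N * b) (M * c + N * d) by rewrite H; exists m, n.
have := Se _ _ Sxy; rewrite xn => /(_ isT); rewrite normrM => exy.
(* The old abscissa is at most [|M| * a + |N| * b], where [a * w] and [b * w] are at most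
   [3 / e]. *)
have xle : e / 3 * `|M * - a + N * b| <= `|N - t * M| / w.
  have eaw : e * (a * w) <= 3.
    have : t * (a * d) <= 2 * 1 by apply: ler_pM => //; rewrite ?mulr_ge0// ltW.
    have : e * (a * c) <= 1.
      by rewrite (le_trans _ ad)// mulrCA ler_pM2l.
    rewrite /w => h1 h2.
    have : e * (t * (a * d)) <= t * (a * d).
      by rewrite ler_piMl// !mulr_ge0// ltW.
    lra.
  have ebw : e * (b * w) <= 3.
    have : e * (b * d) <= 1 by rewrite (le_trans _ bc)// mulrCA ler_pM2l.
    rewrite /w => h1.
    have : t * (e * (b * d)) <= 2 * 1.
      by apply: ler_pM => //; rewrite ?mulr_ge0// ltW.
    have : e * (b * c) <= 1.
      by rewrite (le_trans _ bc)// ler_piMl// mulr_ge0// ltW.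
    lra.
  rewrite ler_pdivlMr// XN.
  have tri : `|M * - a + N * b| <= `|M| * a + `|N| * b.
    rewrite (le_trans (ler_normD _ _))// !normrM normrN.
    by rewrite (gtr0_norm a0) (gtr0_norm b0).
  have k0 : 0 <= e / 3 * w by rewrite mulr_ge0// ?divr_ge0// ltW.
  have := ler_wpM2l k0 tri.
  have : `|M| * (e * (a * w)) <= `|M| * 3 by rewrite ler_wpM2l.
  have : `|N| * (e * (b * w)) <= `|N| * 3 by rewrite ler_wpM2l.
  lra.
rewrite (@le_trans _ _ (e / 3 * e))//.
  have : 0 < e ^+ 2 by rewrite exprn_gt0.
  rewrite expr2; lra.
rewrite (@le_trans _ _ (e / 3 * (`|M * - a + N * b| * `|M * c + N * d|)))//.
  by rewrite ler_pM2l// divr_gt0.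
by rewrite mulrA ler_wpM2r.
Qed.

End Shear.

(** * Boundedness of free boxes, and the free box at a primitive point *)

Section Boxes.
Context {R : realType}.
Implicit Types (S : R -> R -> Prop) (A B x y : R).

Lemma truncn_eq_dist A x y : 0 < A -> 0 <= x -> 0 <= y ->
  Num.truncn (x / A) = Num.truncn (y / A) -> `|x - y| < A.
Proof.
move=> A0 x0 y0 xy.
have /andP[] := truncn_itv (divr_ge0 x0 (ltW A0)).
have /andP[] := truncn_itv (divr_ge0 y0 (ltW A0)).
rewrite xy -addn1 natrD !(ler_pdivlMr, ltr_pdivrMr)// !mulrDl !mul1r.
move: (_ * A) => t h1 h2 h3 h4; rewrite ltr_norml; apply/andP; split; lra.
Qed.

(* Pigeonhole: the (K + 1)^2 combinations with coefficients in [0, K] lie in a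
   rectangle covered by fewer than (K + 1)^2 translates of a quarter of the box. *)
Lemma box_free_volume_bounded S x1 y1 x2 y2 : spans S x1 y1 x2 y2 ->
  x1 * y2 - x2 * y1 != 0 ->
  exists V, forall A B, 0 < A -> 0 < B -> box_free S A B -> A * B <= V.
Proof.
move=> H det; pose X := `|x1| + `|x2|; pose Y := `|y1| + `|y2|.
exists (16 * (X * Y)) => A B A0 B0 AB; rewrite leNgt; apply/negP => XYAB.
have X0 : 0 <= X by rewrite addr_ge0.
have Y0 : 0 <= Y by rewrite addr_ge0.
(* The grid has at most [K ^+ 2 * (4 * (X * Y) / (A * B)) + K * s + 1] cells. The assumed lower
   bound on [A * B] makes the first term at most [K ^+ 2 / 4], and [2 * s <= K] makes the second at
   most [K ^+ 2 / 2]. *)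
pose s := 2 * X / A + 2 * Y / B.
pose K := (Num.bound (2 * s)).+1.
have s0 : 0 <= s by rewrite addr_ge0// divr_ge0// ?mulr_ge0// ltW.
have Ks : 2 * s <= K%:R.
  rewrite (@le_trans _ _ (Num.bound (2 * s))%:R) ?ler_nat// ltW//.
  by rewrite archi_boundP// mulr_ge0.
pose P := Num.truncn (2 * (K%:R * X) / A); pose Q := Num.truncn (2 * (K%:R * Y) / B).
have lin_bound (z1 z2 : R) (m n : 'I_K.+1) :
    0 <= m%:R * z1 + n%:R * z2 + K%:R * (`|z1| + `|z2|) <=
    2 * (K%:R * (`|z1| + `|z2|)).
  have lin1 (z : R) (i : 'I_K.+1) : `|i%:R * z| <= K%:R * `|z|.
    by rewrite normrM ler_wpM2r// ger0_norm// ler_nat -ltnS.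
  have := lin1 z1 m; have := lin1 z2 n; rewrite !ler_norml => /andP[? ?] /andP[? ?].
  by apply/andP; split; lra.
pose f1 (mn : 'I_K.+1 * 'I_K.+1) := mn.1%:R * x1 + mn.2%:R * x2 + K%:R * X.
pose f2 (mn : 'I_K.+1 * 'I_K.+1) := mn.1%:R * y1 + mn.2%:R * y2 + K%:R * Y.
pose f mn : 'I_P.+1 * 'I_Q.+1 :=
  (inord (Num.truncn (f1 mn / A)), inord (Num.truncn (f2 mn / B))).
have /injectivePn[[m n] [[m' n'] mn]] : ~~ injectiveb f.
  apply/negP => /injectiveP/leq_card; rewrite !card_prod !card_ord => PQ.
  have P1 : P%:R <= 2 * (K%:R * X) / A.
    by rewrite truncn_le divr_ge0// ?mulr_ge0// ltW.
  have Q1 : Q%:R <= 2 * (K%:R * Y) / B.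
    by rewrite truncn_le divr_ge0// ?mulr_ge0// ltW.
  have : (K%:R + 1) * (K%:R + 1) <= (2 * (K%:R * X) / A + 1) * (2 * (K%:R * Y) / B + 1).
    rewrite (@le_trans _ _ ((P%:R + 1) * (Q%:R + 1)))//.
      by rewrite !natr1 -!natrM ler_nat.
    by apply: ler_pM; rewrite ?addr_ge0// lerD2r.
  have r : 4 * (X * Y) / (A * B) <= 1 / 4.
    by rewrite ler_pdivrMr ?mulr_gt0//; lra.
  have -> : (2 * (K%:R * X) / A + 1) * (2 * (K%:R * Y) / B + 1) =
      K%:R ^+ 2 * (4 * (X * Y) / (A * B)) + K%:R * s + 1.
    by rewrite /s; field; rewrite !gt_eqF.
  have K0 : 0 < K%:R :> R by rewrite ltr0n.
  have KK : 0 < K%:R ^+ 2 :> R by rewrite exprn_gt0.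
  have := ler_wpM2l (ltW KK) r.
  have := ler_wpM2l (ltW K0) Ks.
  move: KK; rewrite expr2; lra.
move=> /(congr1 (fun p => (nat_of_ord p.1, nat_of_ord p.2)))/=.
have fP mn0 : (Num.truncn (f1 mn0 / A) < P.+1)%N.
  have /andP[f10 f1P] := lin_bound x1 x2 mn0.1 mn0.2.
  by rewrite ltnS le_truncn// ler_pM2r ?invr_gt0.
have fQ mn0 : (Num.truncn (f2 mn0 / B) < Q.+1)%N.
  have /andP[f20 f2P] := lin_bound y1 y2 mn0.1 mn0.2.
  by rewrite ltnS le_truncn// ler_pM2r ?invr_gt0.
rewrite !inordK// => -[e1 e2].
have f1_ge0 mn0 : 0 <= f1 mn0 by have /andP[] := lin_bound x1 x2 mn0.1 mn0.2.
have f2_ge0 mn0 : 0 <= f2 mn0 by have /andP[] := lin_bound y1 y2 mn0.1 mn0.2.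
have d1 := truncn_eq_dist A0 (f1_ge0 _) (f1_ge0 _) e1.
have d2 := truncn_eq_dist B0 (f2_ge0 _) (f2_ge0 _) e2.
have [|d10 d20] := AB (f1 (m, n) - f1 (m', n')) (f2 (m, n) - f2 (m', n')) _ d1 d2.
  rewrite H; exists (m%:Z - m'%:Z), (n%:Z - n'%:Z).
  by rewrite /f1 /f2/=; split; ring.
have dm : (m%:R - m'%:R) * (x1 * y2 - x2 * y1) = 0 :> R.
  transitivity ((f1 (m, n) - f1 (m', n')) * y2 - (f2 (m, n) - f2 (m', n')) * x2).
    by rewrite /f1 /f2/=; ring.
  by rewrite d10 d20; ring.
have dn : (n%:R - n'%:R) * (x1 * y2 - x2 * y1) = 0 :> R.
  transitivity ((f2 (m, n) - f2 (m', n')) * x1 - (f1 (m, n) - f1 (m', n')) * y1).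
    by rewrite /f1 /f2/=; ring.
  by rewrite d10 d20; ring.
move/eqP: dm; rewrite mulf_eq0 (negPf det) orbF subr_eq0 eqr_nat => /eqP/val_inj mm.
move/eqP: dn; rewrite mulf_eq0 (negPf det) orbF subr_eq0 eqr_nat => /eqP/val_inj nn.
by rewrite mm nn eqxx in mn.
Qed.

Lemma spans_swap S x1 y1 x2 y2 :
  spans S x1 y1 x2 y2 -> spans (fun x y => S y x) y1 x1 y2 x2.
Proof. by move=> H x y; rewrite H; split=> -[m [n [-> ->]]]; exists m, n. Qed.

(* At a lattice point (p, q) the number x q - y p is an integer up to sign; in
   this box it is less than 1, so (p, q) is a multiple of (x, y). *)
Lemma primitive_box_free S x1 y1 x2 y2 (m n u v : int) x y :
  spans S x1 y1 x2 y2 -> `|x1 * y2 - x2 * y1| = 1 -> u * m + v * n = 1 ->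
  x = m%:~R * x1 + n%:~R * x2 -> y = m%:~R * y1 + n%:~R * y2 -> x != 0 ->
  box_free S `|x| ((1 - `|x * y|) / `|x|).
Proof.
move=> H det uv xE yE x0 p q /H[i [j [pE qE]]] px qy.
have nx0 : 0 < `|x| by rewrite normr_gt0.
have lt1 : `|x * q - y * p| < 1.
  rewrite (le_lt_trans (ler_normB _ _))// !normrM.
  have : `|x| * `|q| < 1 - `|x * y| by rewrite mulrC -ltr_pdivlMr.
  have : `|y| * `|p| <= `|y| * `|x| by rewrite ler_wpM2l// ltW.
  rewrite normrM; lra.
(* [m * j - n * i] equals [x * q - y * p] up to sign, so it is an integer of absolute value below
   1. *)
have mjni : m * j = n * i.
  apply/eqP; rewrite -subr_eq0 -normr_le0 -ltzD1 add0r -(ltr_int R) intr_norm.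
  rewrite -[X in X < _]mulr1 -[X in _ * X < _]det -normrM.
  apply: le_lt_trans lt1; rewrite le_eqVlt; apply/orP; left; apply/eqP.
  by congr `|_|; rewrite xE yE pE qE; ring.
(* The Bezout relation recovers the multiplier [k] of [(m, n)]. *)
pose k := u * i + v * j.
have iE : i = k * m.
  transitivity ((u * m + v * n) * i); first by rewrite uv mul1r.
  transitivity (u * m * i + v * (n * i)); first by ring.
  by rewrite -mjni /k; ring.
have jE : j = k * n.
  transitivity ((u * m + v * n) * j); first by rewrite uv mul1r.
  transitivity (u * (m * j) + v * n * j); first by ring.
  by rewrite mjni /k; ring.
have pk : p = k%:~R * x by rewrite pE xE iE jE; ring.
have k0 : k = 0.
  apply/eqP; rewrite -normr_le0 -ltzD1 add0r -(ltr_int R) intr_norm.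
  by rewrite -(ltr_pM2r nx0) mul1r -normrM -pk.
by rewrite pk qE iE jE k0; split; ring.
Qed.

End Boxes.

(** * Translation of lattices and the Mordell constant into coordinates *)

Lemma symbox_interior (R : realType) n (a : 'I_n -> R) (x : 'cV[R]_n) :
  (symbox a)° x <-> forall i, `|x i 0| < a i.
Proof.
split=> [/nbhs_ballP[e /= e0 xe] i|xa].
  (* A point of the ball with every coordinate pushed outward; its lying in the box makes the
     inequalities for [x] strict. *)
  pose y := \col_j (x j 0 + (if 0 <= x j 0 then e / 2 else - (e / 2))).
  have e2 : 0 < e / 2 by rewrite divr_gt0.
  have /(_ i) : symbox a y.
    apply: xe; split=> // j k; rewrite ord1 mxE /ball/= opprD addrA subrr add0r.
    by case: ifP => _; rewrite !normrN gtr0_norm//; lra.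
  rewrite mxE => /andP[]; case: ifP => [x0 _ ?|]; first by rewrite ger0_norm//; lra.
  by move=> /negbT; rewrite -ltNge => x0 ? _; rewrite ltr0_norm//; lra.
have xd i : 0 < a i - `|x i 0| by rewrite subr_gt0.
exists (fun i _ => ball (x i 0) (a i - `|x i 0|)).
  by move=> i j; rewrite ord1; apply: nbhsx_ballx.
move=> y xy i; have := xy i 0; rewrite /ball/= ltrBrDl => h.
rewrite -ler_norml ltW// (le_lt_trans _ h)//.
by rewrite -{1}[y i 0](subKr (x i 0)) ler_normB.
Qed.

Lemma ord2E (i : 'I_2) : i = 0 \/ i = 1.
Proof. by case: i => [[|[|//]]] p; [left|right]; apply/val_inj. Qed.

Lemma lift_ord2 : lift ord0 ord0 = 1 :> 'I_2.
Proof. exact/val_inj. Qed.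

Section Bridge.
Context {R : realType}.
Implicit Types (g : 'M[R]_2) (L : ulattice R 2).

Definition cv2 (x y : R) : 'cV[R]_2 := \col_i (if i == 0 then x else y).

Lemma cv2E (v : 'cV[R]_2) : v = cv2 (v 0 0) (v 1 0).
Proof.
by apply/colP => i; rewrite !mxE; have [->|->] := ord2E i.
Qed.

Definition points (L : set 'cV[R]_2) x y := L (cv2 x y).

Lemma points_lattice_of g :
  spans (points (lattice_of g)) (g 0 0) (g 1 0) (g 0 1) (g 1 1).
Proof.
have gz (z : 'cV[int]_2) : g *m map_mx intr z =
    cv2 ((z 0 0)%:~R * g 0 0 + (z 1 0)%:~R * g 0 1)
        ((z 0 0)%:~R * g 1 0 + (z 1 0)%:~R * g 1 1).
  rewrite [LHS]cv2E; congr cv2; rewrite !mxE !big_ord_recl big_ord0 !mxE lift_ord2 addr0.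
    by rewrite mulrC [X in _ + X]mulrC.
  by rewrite mulrC [X in _ + X]mulrC.
move=> x y; split=> [[z _]|[m [n [-> ->]]]].
  rewrite gz => /colP e; exists (z 0 0), (z 1 0).
  by have := e 0; have := e 1; rewrite !mxE /= => <- <-.
by exists (\col_i (if i == 0 then m else n)) => //; rewrite gz !mxE.
Qed.

Lemma det2 g : \det g = g 0 0 * g 1 1 - g 0 1 * g 1 0.
Proof.
rewrite (expand_det_row _ ord0) !big_ord_recl big_ord0 /cofactor !det_mx11 !mxE /=.
rewrite lift_ord2 addr0 expr0 mul1r expr1 mulN1r mulrN.
by congr (_ * g _ _ - _ * g _ _); apply/val_inj.
Qed.

Lemma ulattice_spans L : exists x1 y1 x2 y2,
  spans (points L) x1 y1 x2 y2 /\ `|x1 * y2 - x2 * y1| = 1.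
Proof.
have [g <-] := SL_to_ulattice_surj L.
exists (set_val g 0 0), (set_val g 1 0), (set_val g 0 1), (set_val g 1 1).
split; first exact: points_lattice_of.
have /set_mem := valP g; rewrite /SL/= => g1.
by rewrite -det2 [\det _]g1 normr1.
Qed.

Definition box_areas (S : R -> R -> Prop) : set R :=
  [set r | exists A B, [/\ 0 < A, 0 < B, box_free S A B & r = A * B]].

(** The covolume is 1 and [2 ^+ 2] cancels against the full side lengths, leaving the product of the
    half sides. *)
Lemma kappaE L : kappa L = sup (box_areas (points L)).
Proof.
have [_ L1] := ulatticeP L.
have volE (a : 'I_2 -> R) :
    symbox_vol a / (2 ^+ 2 * covol L) = a 0 * a 1.
  rewrite L1 /symbox_vol !big_ord_recl big_ord0 lift_ord2; by field.
rewrite /kappa; congr (sup _); apply/seteqP; split=> r.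
  move=> [a [a0 aL] <-]; exists (a 0), (a 1); split; rewrite ?volE// => x y Sxy xa ya.
  have /colP xy0 : cv2 x y = 0.
    by apply: aL => //; apply/symbox_interior => i; rewrite mxE; have [->|->] := ord2E i.
  by have := xy0 0; have := xy0 1; rewrite !mxE.
move=> [A [B [A0 B0 AB ->]]]; pose a (i : 'I_2) := if i == 0 then A else B.
exists a; last by rewrite volE.
split=> [i|v Lv /symbox_interior va]; first by rewrite /a; case: ifP.
have [] := AB (v 0 0) (v 1 0); [by rewrite /points -cv2E|exact: (va 0)|exact: (va 1)|].
by move=> v0 v1; rewrite [v]cv2E v0 v1; apply/colP => i; rewrite !mxE; case: ifP.
Qed.

Lemma kappa_ge0 L : 0 <= kappa L.
Proof.
rewrite kappaE.
(* Where no supremum exists, [sup] takes the default value 0. *)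
have [[[r rS] ub]|/sup_out->//] := pselect (has_sup (box_areas (points L))).
rewrite (le_trans _ (ub_le_sup ub rS))//.
by have [A [B [A0 B0 _ ->]]] := rS; rewrite mulr_ge0// ltW.
Qed.

Lemma kappa_ge L A B : 0 < A -> 0 < B -> box_free (points L) A B -> A * B <= kappa L.
Proof.
(* A member bounds [sup] from below only when the set is bounded above, which the pigeonhole
   argument provides. *)
move=> A0 B0 AB; rewrite kappaE; apply: ub_le_sup; last by exists A, B.
have [x1 [y1 [x2 [y2 [H det]]]]] := ulattice_spans L.
have [|V VP] := box_free_volume_bounded H.
  by rewrite -normr_eq0 det oner_eq0.
by exists V => r [A' [B' [A'0 B'0 AB' ->]]]; exact: VP.
Qed.

Lemma kappa_le L e : 0 < e -> product_ge e (points L) -> kappa L <= 1 - e ^+ 2.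
Proof.
move=> e0 Le; have [x1 [y1 [x2 [y2 [H det]]]]] := ulattice_spans L.
have [a [b [c [d D]]]] := divided_exists e0 Le H det.
rewrite kappaE.
have [/set0P ne|/negP/negPn/eqP->] := pselect (box_areas (points L) != set0).
  apply: ge_sup => // r [A [B [A0 B0 AB ->]]].
  exact: (box_free_bound e0 Le A0 B0 AB D).
(* The empty set has [sup] equal to 0, and [e <= 1]. *)
by rewrite sup0 subr_ge0 expr_le1 ?(ltW e0)//; exact: (divided_le1 e0 Le D).
Qed.

(** The box of [primitive_box_free] has area [1 - |x y|], provided that this is positive; otherwise
    [kappa >= 0] suffices. *)
Lemma kappa_primitive L x1 y1 x2 y2 (m n u v : int) x y :
  spans (points L) x1 y1 x2 y2 -> `|x1 * y2 - x2 * y1| = 1 -> u * m + v * n = 1 ->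
  x = m%:~R * x1 + n%:~R * x2 -> y = m%:~R * y1 + n%:~R * y2 ->
  1 - kappa L <= `|x * y|.
Proof.
move=> H det uv xE yE.
have [xy1|xy1] := leP 1 `|x * y|.
  by rewrite (le_trans _ xy1)// gerBl kappa_ge0.
have xy0 : 0 < 1 - `|x * y| by rewrite subr_gt0.
(* For a point on the vertical axis the box is built with the two axes exchanged. *)
have [x0|x0] := eqVneq x 0; last first.
  have nx0 : 0 < `|x| by rewrite normr_gt0.
  have := kappa_ge nx0 (divr_gt0 xy0 nx0) (primitive_box_free H det uv xE yE x0).
  by rewrite mulrC divfK ?gt_eqF//; lra.
have y0 : y != 0.
  apply/eqP => y0; have m0 : m%:~R * (x1 * y2 - x2 * y1) = 0 :> R.
    transitivity (x * y2 - y * x2); first by rewrite xE yE; ring.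
    by rewrite x0 y0; ring.
  have n0 : n%:~R * (x1 * y2 - x2 * y1) = 0 :> R.
    transitivity (y * x1 - x * y1); first by rewrite xE yE; ring.
    by rewrite x0 y0; ring.
  have d0 : x1 * y2 - x2 * y1 != 0 by rewrite -normr_eq0 det oner_eq0.
  move/eqP: m0; rewrite mulf_eq0 (negPf d0) orbF intr_eq0 => /eqP m0.
  move/eqP: n0; rewrite mulf_eq0 (negPf d0) orbF intr_eq0 => /eqP n0.
  by move: uv; rewrite m0 n0 !mulr0 addr0.
have ny0 : 0 < `|y| by rewrite normr_gt0.
have det' : `|y1 * x2 - y2 * x1| = 1 by rewrite -det -normrN; congr `|_|; ring.
have bf := primitive_box_free (spans_swap H) det' uv yE xE y0.
rewrite [y * x]mulrC in bf.
have /(kappa_ge (divr_gt0 xy0 ny0) ny0) :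
    box_free (points L) ((1 - `|x * y|) / `|y|) `|y|.
  by move=> p q Spq px qy; have [] := bf q p Spq qy px.
by rewrite divfK ?gt_eqF//; lra.
Qed.

(** Dividing by the gcd of the coefficients gives a primitive point with no larger [|x y|]. *)
Lemma product_ge_kappa L : product_ge (1 - kappa L) (points L).
Proof.
have [x1 [y1 [x2 [y2 [H det]]]]] := ulattice_spans L.
move=> x y Lxy xy; have := Lxy; rewrite H => -[i [j [xE yE]]].
have [u [v uv]] := Bezoutz i j.
pose h := gcdz i j.
have /dvdzP[m mE] : (h %| i)%Z := dvdz_gcdl i j.
have /dvdzP[n nE] : (h %| j)%Z := dvdz_gcdr i j.
have h0 : h != 0.
  rewrite /h gcdz_eq0; apply: contraL xy => /andP[/eqP i0 /eqP j0].
  by rewrite xE yE i0 j0 !mul0r addr0 eqxx.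
have {}uv : u * i + v * j = h by [].
clearbody h.
have umvn : u * m + v * n = 1.
  by apply: (mulIf h0); rewrite mul1r -[RHS]uv mE nE; ring.
have := kappa_primitive H det umvn erefl erefl; move/le_trans; apply.
have -> : x = h%:~R * (m%:~R * x1 + n%:~R * x2) by rewrite xE mE nE; ring.
have -> : y = h%:~R * (m%:~R * y1 + n%:~R * y2) by rewrite yE mE nE; ring.
set p := m%:~R * x1 + _; set q := m%:~R * y1 + _.
rewrite mulrACA [X in _ <= X]normrM ler_peMl// -intrM -intr_norm ler1z.
by rewrite -gtz0_ge1 normr_gt0 mulf_neq0.
Qed.

End Bridge.

(** * Small shears of a lattice, and the diagonal orbit *)

Section Perturbation.
Context {R : realType}.
Implicit Types (g : 'M[R]_2) (L : ulattice R 2).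

Definition shear_mx (s : R) g : 'M[R]_2 :=
  \matrix_(i, j) (g i j + (if i == 0 then s * g 1 j else 0)).

Lemma det_shear_mx s g : \det (shear_mx s g) = \det g.
Proof. by rewrite !det2 !mxE /=; ring. Qed.

Lemma points_shear_mx s g :
  points (lattice_of (shear_mx s g)) = shear s (points (lattice_of g)).
Proof.
apply/funext => x; apply/funext => y; apply/propext.
rewrite (points_lattice_of (shear_mx s g) x y).
by rewrite (spans_shear s (points_lattice_of g) x y) !mxE /= !addr0.
Qed.

(** A neighbourhood of [L] pulls back to matrices near a representative [g], and the shear only adds
    [s] times the second row of [g] to the first. *)
Lemma nbhs_shear L (U : set (ulattice R 2)) : nbhs L U ->
  exists2 r, 0 < r & forall s, `|s| < r ->
    exists L', U L' /\ points L' = shear s (points L).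
Proof.
rewrite nbhsE => -[V [Vop VL] VU].
have [g gL] := SL_to_ulattice_surj L.
have [W Wop WV] : ulattice_open V by exact: Vop.
have Wg : W (set_val g).
  have : (@SL_to_ulattice R 2 @^-1` V) g by rewrite /preimage/= gL.
  by rewrite -WV.
have /nbhs_ballP[e /= e0 We] : nbhs (set_val g) W by apply: open_nbhs_nbhs.
pose M := `|set_val g 1 0| + `|set_val g 1 1| + 1.
have M0 : 0 < M by rewrite ltr_wpDl// addr_ge0.
exists (e / M) => [|s]; first by rewrite divr_gt0.
rewrite ltr_pdivlMr// => sM.
have sg : shear_mx s (set_val g) \in SL R 2.
  by apply/mem_set; rewrite /SL/= det_shear_mx; have /set_mem := valP g.
exists (SL_to_ulattice (SigSub sg)); split; last first.
  by rewrite /= points_shear_mx -gL.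
apply: VU; have : (set_val @^-1` W) (SigSub sg : SL R 2); last by rewrite WV.
apply: We; split=> // i j; rewrite mxE /ball/= opprD addrA subrr add0r normrN.
case: ifP => _; last by rewrite normr0.
rewrite normrM (le_lt_trans _ sM)// ler_wpM2l// /M.
have [->|->] := ord2E j.
  by rewrite -addrA lerDl addr_ge0.
by rewrite addrAC lerDr addr_ge0.
Qed.

(** For heights at least [T = 1 / r + 2], the area forces [a] and [b] below [1 / T]. The numerator
    is then at most [3 / T], whereas [r * (c + t * d) >= 2] and [T > 2]. *)
Lemma shear_to_small t a b c d r (S : R -> R -> Prop) : divided S a b c d ->
  1 <= t -> t <= 2 -> 0 < r -> 1 / r + 2 <= c -> 1 / r + 2 <= d ->
  `|shear_to t a b c d| < r.
Proof.
move=> [[a0 b0 c0 d0] h _] t1 t2 r0; set T := 1 / r + 2 => Tc Td.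
have T2 : 2 < T by rewrite /T ltrDr divr_gt0.
have rT : r * T = 1 + 2 * r by rewrite /T; field; rewrite gt_eqF.
have td : d <= t * d by rewrite ler_peMl// ltW.
have w0 : 0 < c + t * d by rewrite addr_gt0// mulr_gt0; lra.
rewrite /shear_to normrM [`|_^-1|]gtr0_norm ?invr_gt0// ltr_pdivrMr//.
have aT : a * T <= 1.
  have : a * T <= a * d by rewrite ler_pM2l.
  have : 0 < b * c by rewrite mulr_gt0.
  lra.
have bT : b * T <= 1.
  have : b * T <= b * c by rewrite ler_pM2l.
  have : 0 < a * d by rewrite mulr_gt0.
  lra.
have tb : t * b <= 2 * b by rewrite ler_pM2r.
have tb0 : 0 < t * b by rewrite mulr_gt0; lra.
have nle : `|a - t * b| <= a + 2 * b by rewrite ler_norml; apply/andP; split; lra.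
apply: (le_lt_trans nle).
have T0 : 0 < T by lra.
rewrite -(ltr_pM2r T0) (@le_lt_trans _ _ 3)//; first lra.
have wT : T + T <= c + t * d by lra.
have : r * (T + T) <= r * (c + t * d) by rewrite ler_pM2l.
rewrite mulrDr rT => h1.
have h2 : 2 <= r * (c + t * d) by lra.
have : 2 * T <= r * (c + t * d) * T by rewrite ler_pM2r.
lra.
Qed.

Lemma diag_orbit_points L L' : diag_orbit L L' ->
  exists2 u : R * R, u.1 != 0 /\ u.2 != 0 &
    forall x y, points L' x y <-> points L (x / u.1) (y / u.2).
Proof.
move=> [a [_ [/is_diag_mxP ad a0]] LE].
have n0 : a 0 0 != 0 by rewrite gt_eqF.
have n1 : a 1 1 != 0 by rewrite gt_eqF.
have aE (x y : R) : a *m cv2 x y = cv2 (a 0 0 * x) (a 1 1 * y).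
  rewrite [LHS]cv2E; congr cv2; rewrite !mxE !big_ord_recl big_ord0 !mxE lift_ord2 /=.
    by rewrite (ad 0 1)// mul0r !addr0.
  by rewrite (ad 1 0)// mul0r add0r addr0.
exists (a 0 0, a 1 1) => //= x y; rewrite /points LE; split=> [[v Lv e]|Lxy].
  move: e Lv; rewrite {1 2}[v]cv2E aE => /colP e.
  have := e 0; have := e 1; rewrite !mxE /= => <- <-.
  by rewrite ![_ * v _ _]mulrC !mulfK// -cv2E.
exists (cv2 (x / a 0 0) (y / a 1 1)) => //.
by rewrite aE mulrCA divff// mulrCA divff// !mulr1.
Qed.

(** The two scalings would combine into one carrying [L3] into [L2]. The abscissas of these lattices
    are multiples of [Z + Z sqrt 3] and [Z + Z sqrt 2], so some nonzero [k] would have both [k] and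
    [sqrt 3 * k] in [Z + Z sqrt 2]. *)
Lemma sqrt2_sqrt3_orbits L L2 L3 a b c d : divided (points L) a b c d ->
  points L2 = shear (shear_to (Num.sqrt 2) a b c d) (points L) ->
  points L3 = shear (shear_to (Num.sqrt 3) a b c d) (points L) ->
  ~ (diag_orbit L L2 /\ diag_orbit L L3).
Proof.
move=> D L2E L3E [/diag_orbit_points[[u2 v2] [/= u20 v20] H2]].
move=> /diag_orbit_points[[u3 v3] [/= u30 v30] H3].
have s2 : 0 < Num.sqrt 2 :> R by rewrite sqrtr_gt0.
have s3 : 0 < Num.sqrt 3 :> R by rewrite sqrtr_gt0.
have [_ _] := divided_shear s2 D; rewrite -L2E.
have [_ _] := divided_shear s3 D; rewrite -L3E.
have [[a0 b0 c0 d0] _ _] := D.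
set w3 := c + _ * d; set w2 := c + _ * d => B3 B2.
have w20 : w2 != 0 by rewrite gt_eqF// addr_gt0// mulr_gt0.
have w30 : w3 != 0 by rewrite gt_eqF// addr_gt0// mulr_gt0.
pose k := u2 / u3 * (w2 / w3).
have k0 : k != 0 by rewrite !mulf_neq0 ?invr_neq0.
have L32 x y : points L3 x y -> points L2 (x * (u2 / u3)) (y * (v2 / v3)).
  rewrite H3 H2; congr (points L _ _); first by field; rewrite u20 u30.
  by field; rewrite v20 v30.
have := L32 _ _ (spans1 (spansC B3)); rewrite B2 => -[k1 [l1 [e1 _]]].
have := L32 _ _ (spans1 B3); rewrite B2 => -[i1 [j1 [e2 _]]].
have kE : l1%:~R + (- k1)%:~R * Num.sqrt 2 = k.
  transitivity (w2 * (1 / w3 * (u2 / u3))); first by rewrite e1; field.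
  by rewrite /k; field; rewrite u30 w30.
have := @sqrt2_sqrt3_indep R i1 (- j1) (- k1) l1.
rewrite kE => ind; move: k0; rewrite ind ?eqxx//.
transitivity (- w2 * (- (Num.sqrt 3 / w3) * (u2 / u3))).
  by rewrite /k; field; rewrite u30 w30.
by rewrite e2; field.
Qed.

End Perturbation.

Theorem theorem1p12 : forall (R : realType) (L : ulattice R 2),
  ~ strongly_isolated L.
Proof.
move=> R L [e0 iso]; set e := 1 - kappa L in e0 iso.
have Le : product_ge e (points L) by exact: product_ge_kappa.
have [x1 [y1 [x2 [y2 [H det]]]]] := ulattice_spans L.
have [a0 [b0 [c0 [d0 D0]]]] := divided_exists e0 Le H det.
have e1 := divided_le1 e0 Le D0.
pose f := e ^+ 2 / 6.
have ee : e ^+ 2 <= e by rewrite expr2 ler_piMl// ltW.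
have f0 : 0 < f by rewrite divr_gt0// exprn_gt0.
have f2e : f ^+ 2 < e.
  have f1 : f <= 1 by rewrite /f; lra.
  have : f ^+ 2 <= f by rewrite expr2 ler_piMl// ltW.
  rewrite {2}/f; lra.
(* [kappa L + (e - f ^+ 2)] is [1 - f ^+ 2], the upper bound that [kappa_le] gives under
   [product_ge f]. *)
have [||U LU UP] := iso (e - f ^+ 2); first by rewrite subr_gt0.
  by rewrite gtrBl exprn_gt0.
have [r r0 rP] := nbhs_shear LU.
(* At this height the shears to both ratios are smaller than [r]. *)
have [a [b [c [d [D Tc Td]]]]] := divided_high e0 Le (1 / r + 2) D0.
have near (p : nat) : prime p -> (p <= 4)%N -> exists L', diag_orbit L L' /\
    points L' = shear (shear_to (Num.sqrt p%:R) a b c d) (points L).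
  move=> pp p4; have t1 : 1 <= Num.sqrt p%:R :> R.
    by rewrite -[X in X <= _]sqrtr1 ler_wsqrtr// ler1n prime_gt0.
  have t2 : Num.sqrt p%:R <= 2 :> R.
    by rewrite -(@ler_pXn2r _ 2)// ?nnegrE ?sqrtr_ge0// sqr_sqrtr// -natrX ler_nat.
  have [L' [UL' L'E]] := rP _ (shear_to_small D t1 t2 r0 Tc Td).
  (* Outside the orbit isolation would force [kappa L' > 1 - f ^+ 2], so the sheared lattice must
     lie in the orbit. *)
  exists L'; split=> //; apply: contrapT => nL'.
  have := UP L' (conj UL' nL'); apply/negP; rewrite -leNgt.
  have L'f : product_ge f (points L') by rewrite L'E; exact: product_ge_shear.
  by rewrite (le_trans (kappa_le f0 L'f))// /e; lra.
have [L2 [inA2 E2]] := near 2 isT isT.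
have [L3 [inA3 E3]] := near 3 isT isT.
exact: sqrt2_sqrt3_orbits D E2 E3 (conj inA2 inA3).
Qed.
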